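(* A locally convex space $E$ is topologically isomorphic to $\varphi=L(\omega)$ if and only if $E$ is an infinite-dimensional $k_{\mathbb R}$-space containing no infinite-dimensional compact subset.
   Context: $\varphi=L(\omega)$ is a vector space of countably infinite Hamel dimension endowed with the finest locally convex topology. A topological space $X$ is a $k_{\mathbb R}$-space if a function $f:X\to\mathbb R$ is continuous whenever its restriction $f\restriction K$ is continuous for every compact $K\subseteq X$. A compact subset is infinite-dimensional if it has infinite topological dimension (equivalently, here, it is not contained in a finite-dimensional subspace).
   Formalization: The locally convex space E is assumed Hausdorff (the usual convention); without this the converse fails, e.g. for the product of φ with an indiscrete line. *)

(* Defs.v *)
(* Locally convex spaces = [tvsType R] (mathcomp's
   tvsType is by definition a locally convex topological vector space). *)
From HB Require Import structures.
From mathcomp Require Import all_boot all_order all_algebra.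
From mathcomp Require Import all_classical all_reals all_analysis.
Set Implicit Arguments. Unset Strict Implicit. Unset Printing Implicit Defensive.
Import Order.TTheory GRing.Theory Num.Theory.
Local Open Scope classical_set_scope.
Local Open Scope ring_scope.

Section Defs.
Context {R : realType}.

Definition in_span {E : lmodType R} (s : seq E) (x : E) : Prop :=
  exists c : nat -> R, x = \sum_(i < size s) c i *: s`_i.

Definition finite_dim_set {E : lmodType R} (A : set E) : Prop :=
  exists s : seq E, A `<=` in_span s.

Definition infinite_dim_set {E : lmodType R} (A : set E) : Prop :=
  ~ finite_dim_set A.

Definition infinite_dimensional (E : lmodType R) : Prop :=
  ~ finite_dim_set (@setT E).

Definition lin_indep_seq {E : lmodType R} (b : nat -> E) : Prop :=
  forall (n : nat) (c : nat -> R),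
    \sum_(i < n) c i *: b i = 0 -> forall i, (i < n)%N -> c i = 0.
Definition spanning_seq {E : lmodType R} (b : nat -> E) : Prop :=
  forall x : E, exists (n : nat) (c : nat -> R), x = \sum_(i < n) c i *: b i.
Definition countably_infinite_hamel_dim (E : lmodType R) : Prop :=
  exists b : nat -> E, lin_indep_seq b /\ spanning_seq b.

Definition balanced {E : lmodType R} (A : set E) : Prop :=
  forall (l : R) (x : E), `|l| <= 1 -> A x -> A (l *: x).
Definition absorbing {E : lmodType R} (A : set E) : Prop :=
  forall x : E, exists2 r : R, 0 < r &
    forall l : R, `|l| <= r -> A (l *: x).

Definition finest_lc_topology (E : tvsType R) : Prop :=
  forall A : set E, convex_set A -> balanced A -> absorbing A -> nbhs 0 A.

Definition is_phi (V : tvsType R) : Prop :=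
  countably_infinite_hamel_dim V /\ finest_lc_topology V.

Definition top_iso {E V : tvsType R} (f : E -> V) : Prop :=
  [/\ forall (a : R) (x y : E), f (a *: x + y) = a *: f x + f y,
      continuous f &
      exists2 g : V -> E, cancel f g /\ cancel g f & continuous g].

Definition top_isomorphic (E V : tvsType R) : Prop :=
  exists f : E -> V, top_iso f.

Definition kR_space (X : topologicalType) : Prop :=
  forall f : X -> R^o,
    (forall K : set X, compact K -> {within K, continuous f}) -> continuous f.

End Defs.

(* Main.v *)
(* Fix a Hamel basis of E with its coordinate functionals.  The finest locally
   convex topology is the one for which every weighted l^1 seminorm
   x |-> sum_i w_i |x_i| is continuous.

   (=>) Let E have countable dimension and the finest topology.  If a compact set
   had points x_n with a nonzero coordinate of index >= n for each n, suitable
   weights would make a continuous seminorm unbounded on it.  If f is continuous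
   on compact sets, a tube-lemma argument chooses d_0, d_1, ... > 0 inductively so
   that f stays e-close to f(x0) on every box x0 + {|x_i| <= d_i, i < n}; the
   union of these boxes is a neighbourhood of x0.

   (<=) In a Hausdorff space weighted seminorms are continuous on
   finite-dimensional subsets, so the k_R property makes them continuous and E
   carries the finest topology.  Suppose the basis were uncountable.  Well-order
   it, and let J consist of the indices i with countably many predecessors; J is
   uncountable.  Choose injections h_i from the predecessors of i to the naturals
   and put f(x) = sum_{i,j} h_i(j) |x_i| |x_j|.  This f is continuous on
   finite-dimensional sets, hence continuous, so there are e_i > 0 with
   h_i(j) e_i e_j < 1 for all i <> j; but 1/e_i <= m for uncountably many i in J,
   and then the injections h_i would be bounded by m^2 on arbitrarily long finite
   sets. *)
Require Import Defs.
From HB Require Import structures.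
From mathcomp Require Import all_boot all_order all_algebra.
From mathcomp Require Import all_classical all_reals all_analysis.
From mathcomp Require Import ring lra.
Import Order.TTheory GRing.Theory Num.Theory.
Import numFieldNormedType.Exports.
Local Open Scope classical_set_scope.
Local Open Scope ring_scope.
Set Implicit Arguments.
Unset Strict Implicit.
Unset Printing Implicit Defensive.

(** * Finite linear combinations, Hamel bases and coordinates *)

Lemma big_seq_subset (I : eqType) (V : nmodType) (s t : seq I) (F : I -> V) :
  uniq s -> uniq t -> {subset s <= t} ->
  (forall i, i \in t -> i \notin s -> F i = 0) ->
  \sum_(i <- t) F i = \sum_(i <- s) F i.
Proof.
move=> us ut st F0; rewrite (bigID (mem s)) /= [X in _ + X]big_seq_cond.
rewrite [X in _ + X]big1 ?addr0; last by move=> i /andP[/F0].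
rewrite -big_filter; apply: perm_big; apply: uniq_perm => //.
  exact: filter_uniq.
by move=> i; rewrite mem_filter; case: (boolP (i \in s)) => //= /st.
Qed.

Section LinearAlgebra.
Context {R : realType} {E : lmodType R}.

(** Only a finite list covering the nonzero coordinates is asked of [supp x]; it may also contain
    indices whose coordinate is zero. *)
Record hamel (I : choiceType) := Hamel {
  vec : I -> E;
  co : I -> E -> R;
  supp : E -> seq I;
  supp_uniq : forall x, uniq (supp x);
  co_lin : forall i a x y, co i (a *: x + y) = a * co i x + co i y;
  co_vec : forall i j, co i (vec j) = (i == j)%:R;
  co_decomp : forall x, x = \sum_(i <- supp x) co i x *: vec i
}.

Definition spanned (I : eqType) (b : I -> E) (x : E) : Prop :=
  exists s (c : I -> R), uniq s /\ x = \sum_(i <- s) c i *: b i.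

Definition independent (I : eqType) (b : I -> E) : Prop :=
  forall s (c : I -> R), uniq s ->
    \sum_(i <- s) c i *: b i = 0 -> forall i, i \in s -> c i = 0.

Lemma spanned_vec (I : eqType) (b : I -> E) i : spanned b (b i).
Proof.
by exists [:: i], (fun=> 1); split => //; rewrite big_seq1 scale1r.
Qed.

Lemma spanned0 (I : eqType) (b : I -> E) : spanned b 0.
Proof. by exists [::], (fun=> 0); rewrite big_nil. Qed.

Lemma sum_widen (I : eqType) (b : I -> E) s t (c : I -> R) :
  uniq s -> uniq t -> {subset s <= t} ->
  \sum_(i <- s) c i *: b i =
  \sum_(i <- t) (if i \in s then c i else 0) *: b i.
Proof.
move=> us ut st; rewrite (big_seq_subset us ut st).
  by rewrite !big_seq; apply: eq_bigr => i ->.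
by move=> i _ /negPf ->; rewrite scale0r.
Qed.

Lemma sum_lincomb (I : eqType) (b : I -> E) s1 s2 (c1 c2 : I -> R) a :
  uniq s1 -> uniq s2 ->
  a *: (\sum_(i <- s1) c1 i *: b i) + \sum_(i <- s2) c2 i *: b i =
  \sum_(i <- undup (s1 ++ s2)) (a * (if i \in s1 then c1 i else 0) +
     (if i \in s2 then c2 i else 0)) *: b i.
Proof.
move=> u1 u2; have ut := undup_uniq (s1 ++ s2).
have st1 : {subset s1 <= undup (s1 ++ s2)}.
  by move=> i; rewrite mem_undup mem_cat => ->.
have st2 : {subset s2 <= undup (s1 ++ s2)}.
  by move=> i; rewrite mem_undup mem_cat => ->; rewrite orbT.
rewrite (sum_widen b c1 u1 ut st1) (sum_widen b c2 u2 ut st2).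
rewrite scaler_sumr -big_split /=.
by apply: eq_bigr => i _; rewrite scalerA -scalerDl.
Qed.

Lemma spannedD (I : eqType) (b : I -> E) a x y :
  spanned b x -> spanned b y -> spanned b (a *: x + y).
Proof.
move=> [s1 [c1 [u1 ->]]] [s2 [c2 [u2 ->]]]; rewrite sum_lincomb //.
exists (undup (s1 ++ s2)).
by eexists; split; [exact: undup_uniq|].
Qed.

Lemma spanned_sum (I : eqType) (b : I -> E) (J : eqType) (s : seq J)
    (c : J -> R) (v : J -> E) :
  (forall j, j \in s -> spanned b (v j)) ->
  spanned b (\sum_(j <- s) c j *: v j).
Proof.
elim: s => [|j s ih] sv; first by rewrite big_nil; exact: spanned0.
rewrite big_cons; apply: spannedD; first by apply: sv; rewrite mem_head.
by apply: ih => k ks; apply: sv; rewrite inE ks orbT.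
Qed.

Lemma independent_unique (I : eqType) (b : I -> E) s1 s2 (c1 c2 : I -> R) :
  independent b -> uniq s1 -> uniq s2 ->
  \sum_(i <- s1) c1 i *: b i = \sum_(i <- s2) c2 i *: b i ->
  forall i, (if i \in s1 then c1 i else 0) = (if i \in s2 then c2 i else 0).
Proof.
move=> ib u1 u2 e i; have /esym := sum_lincomb b c1 c2 (-1) u1 u2.
rewrite e scaleN1r addNr => s0; have := ib _ _ (undup_uniq _) s0 i.
rewrite mem_undup mem_cat mulN1r.
case: ifPn => i1; case: ifPn => i2 //= /(_ isT) /eqP.
- by rewrite addrC subr_eq0 => /eqP.
- by rewrite addr0 oppr_eq0 => /eqP.
- by rewrite oppr0 add0r => /eqP.
Qed.

(** Choice fixes one representation of each vector. By independence the coefficients do not depend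
    on that choice, which makes the coordinates linear. *)
Lemma hamel_of_basis (I : choiceType) (b : I -> E) :
  independent b -> (forall x, spanned b x) -> exists H : hamel I, vec H = b.
Proof.
move=> ib sb.
have /choice[S Sp] : forall x, exists sc : seq I * (I -> R),
    uniq sc.1 /\ x = \sum_(i <- sc.1) sc.2 i *: b i.
  by move=> x; have [s [c ?]] := sb x; exists (s, c).
pose k i x := if i \in (S x).1 then (S x).2 i else 0.
have kE i x s (c : I -> R) : uniq s -> x = \sum_(i <- s) c i *: b i ->
    k i x = if i \in s then c i else 0.
  move=> us e; have [ux ex] := Sp x.
  by apply: (independent_unique ib ux us); rewrite -ex.
suff H : [/\ forall i a x y, k i (a *: x + y) = a * k i x + k i y,
     forall i j, k i (b j) = (i == j)%:R
   & forall x, x = \sum_(i <- (S x).1) k i x *: b i].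
  have [H1 H2 H3] := H.
  by exists (@Hamel I b k (fun x => (S x).1) (fun x => (Sp x).1) H1 H2 H3).
split.
- move=> i a x y; have [ux ex] := Sp x; have [uy ey] := Sp y.
  have := sum_lincomb b (S x).2 (S y).2 a ux uy; rewrite -ex -ey.
  move=> /(kE i _ _ _ (undup_uniq _)) ->; rewrite mem_undup mem_cat /k.
  by case: (i \in (S x).1); case: (i \in (S y).1); rewrite //= mulr0 addr0.
- move=> i j; rewrite (@kE i (b j) [:: j] (fun=> 1)) ?big_seq1 ?scale1r//.
  by rewrite inE; case: eqP.
- move=> x; have [ux ex] := Sp x; rewrite {1}ex !big_seq.
  by apply: eq_bigr => i ix; rewrite /k ix.
Qed.

Section Coordinates.
Context {I : choiceType} (H : hamel I).

Lemma co0 i : co H i 0 = 0.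
Proof. by have := co_lin H i 1 0 0; rewrite scaler0 addr0; lra. Qed.

Lemma coD i x y : co H i (x + y) = co H i x + co H i y.
Proof. by rewrite -[x]scale1r co_lin mul1r scale1r. Qed.

Lemma coZ i a x : co H i (a *: x) = a * co H i x.
Proof. by rewrite -[a *: x]addr0 co_lin co0 addr0. Qed.

Lemma coB i x y : co H i (x - y) = co H i x - co H i y.
Proof. by rewrite -scaleN1r coD coZ mulN1r. Qed.

Lemma co_sum (J : Type) i (s : seq J) (c : J -> R) (v : J -> E) :
  co H i (\sum_(j <- s) c j *: v j) = \sum_(j <- s) c j * co H i (v j).
Proof.
elim: s => [|j s ih]; first by rewrite !big_nil co0.
by rewrite !big_cons co_lin ih.
Qed.

Lemma mem_supp i x : co H i x != 0 -> i \in supp H x.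
Proof.
apply: contraNT => ix; rewrite [x in co _ _ x](co_decomp H) co_sum.
rewrite big_seq big1 // => j jx; rewrite co_vec.
by case: eqP => [ij|]; rewrite ?mulr0 //; rewrite ij jx in ix.
Qed.

(** Both sums reduce to the indices of [s] with nonzero coordinate. Hence several vectors can be
    treated over one common list. *)
Lemma sum_supp (V : nmodType) (F : I -> V) x s : uniq s ->
  (forall i, co H i x != 0 -> i \in s) -> (forall i, co H i x = 0 -> F i = 0) ->
  \sum_(i <- supp H x) F i = \sum_(i <- s) F i.
Proof.
move=> us xs F0.
pose t := [seq i <- s | co H i x != 0].
have ut : uniq t by exact: filter_uniq.
have tF i : i \notin t -> (i \in s) || (i \in supp H x) -> F i = 0.
  rewrite mem_filter negb_and negbK => /orP[/eqP/F0 //|] /negPf is_.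
  by rewrite is_ /= => _; apply/F0/eqP; apply: contraFT is_; exact: xs.
rewrite (@big_seq_subset _ _ t (supp H x)) ?supp_uniq //.
- rewrite (@big_seq_subset _ _ t s) //.
    by move=> i; rewrite mem_filter => /andP[].
  by move=> i is_ /tF; apply; rewrite is_.
- by move=> i; rewrite mem_filter => /andP[/mem_supp].
- by move=> i is_ /tF; apply; rewrite is_ orbT.
Qed.

Lemma decomp_supp x s : uniq s -> (forall i, co H i x != 0 -> i \in s) ->
  x = \sum_(i <- s) co H i x *: vec H i.
Proof.
move=> us xs; rewrite [LHS](co_decomp H); apply: sum_supp => // i ->.
by rewrite scale0r.
Qed.

Lemma co_eq0 x : (forall i, co H i x = 0) -> x = 0.
Proof.
by move=> x0; rewrite (co_decomp H x) big1 // => i _; rewrite x0 scale0r.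
Qed.

Definition wsum (w : I -> R) (x : E) := \sum_(i <- supp H x) w i * `|co H i x|.

Lemma wsumE w x s : uniq s -> (forall i, co H i x != 0 -> i \in s) ->
  wsum w x = \sum_(i <- s) w i * `|co H i x|.
Proof. by move=> us xs; apply: sum_supp => // i ->; rewrite normr0 mulr0. Qed.

Lemma wsumZ w a x : wsum w (a *: x) = `|a| * wsum w x.
Proof.
rewrite (@wsumE w (a *: x) (supp H x)) ?supp_uniq //; last first.
  by move=> i; rewrite coZ mulf_eq0 negb_or => /andP[_ /mem_supp].
rewrite mulr_sumr; apply: eq_bigr => i _; rewrite coZ normrM; lra.
Qed.

Lemma wsumD (w : I -> R) x y : (forall i, 0 <= w i) ->
  wsum w (x + y) <= wsum w x + wsum w y.
Proof.
move=> w0; pose s := undup (supp H x ++ supp H y).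
have us : uniq s by exact: undup_uniq.
have sx i : co H i x != 0 -> i \in s.
  by move=> /mem_supp ix; rewrite mem_undup mem_cat ix.
have sy i : co H i y != 0 -> i \in s.
  by move=> /mem_supp ix; rewrite mem_undup mem_cat ix orbT.
rewrite (wsumE w us sx) (wsumE w us sy) (@wsumE w (x + y) s) //; last first.
  move=> i; have [/eqP|/sx //] := boolP (co H i x == 0).
  by rewrite coD => ->; rewrite add0r; exact: sy.
rewrite -big_split; apply: ler_sum => i _ /=.
by rewrite -mulrDr ler_wpM2l// coD ler_normD.
Qed.

Lemma wsum_ge0 (w : I -> R) x : (forall i, 0 <= w i) -> 0 <= wsum w x.
Proof. by move=> w0; apply: sumr_ge0 => i _; rewrite mulr_ge0. Qed.

Lemma wsum_ge (w : I -> R) x i : (forall i, 0 <= w i) ->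
  w i * `|co H i x| <= wsum w x.
Proof.
move=> w0; have [/eqP ->|/mem_supp ix] := boolP (co H i x == 0).
  by rewrite normr0 mulr0 wsum_ge0.
rewrite /wsum (big_rem i ix) /= lerDl.
by apply: sumr_ge0 => j _; rewrite mulr_ge0.
Qed.

End Coordinates.
End LinearAlgebra.
Arguments hamel {R} E I.

(** * Neighbourhoods of zero, seminorms and the finest topology *)

Lemma convex_setE (R : realType) (E : lmodType R) (A : set E) :
  convex_set (A : set (convex_lmodType E)) <->
  forall x y (t : R), 0 <= t -> t <= 1 -> A x -> A y ->
    A (t *: x + (1 - t) *: y).
Proof.
split=> [cA x y t t0 t1 Ax Ay|cA x y l].
  by have := cA x y (Itv01 t0 t1); rewrite !inE; apply.
by rewrite !inE => Ax Ay; exact: (cA x y l%:num).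
Qed.

Section Tvs.
Context {R : realType} {E : tvsType R}.

Lemma nbhs_shift (x : E) (U : set E) :
  nbhs x U <-> nbhs 0 [set v | U (x + v)].
Proof.
split=> [xU|/(nbhsT x)].
  have := nbhsB (- x) xU; rewrite addNr.
  by apply: filterS => _ [u Uu <-] /=; rewrite addrA addrN add0r.
by apply: filterS => _ [u Uu <-].
Qed.

Lemma continuous_addr (x : E) : continuous (+%R x : E -> E).
Proof.
move=> v; apply: (@continuous2_cvg _ _ _ _ _ _ _ _ (fun x y : E => x + y)).
- exact: (add_continuous (x, v)).
- exact: cvg_cst.
- exact: cvg_id.
Qed.

Lemma continuous_addl_scale (v : E) :
  continuous (fun xt : E * R^o => xt.1 + xt.2 *: v).
Proof.
move=> xt; apply: (@continuous2_cvg _ _ _ _ _ _ _ _ (fun x y : E => x + y)).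
- exact: (add_continuous (xt.1, xt.2 *: v)).
- exact: cvg_fst.
- apply: (@continuous2_cvg _ _ _ _ _ _ _ _ (fun (t : R^o) (y : E) => t *: y)).
  + exact: (scale_continuous (xt.2, v)).
  + exact: cvg_snd.
  + exact: cvg_cst.
Qed.

Lemma continuous_dominated (p : E -> R) (f : E -> R^o) :
  (forall e, 0 < e -> nbhs 0 [set x | p x < e]) ->
  (forall x y, `|f x - f y| <= p (y - x)) -> continuous f.
Proof.
move=> np fp x; apply/cvgrPdist_lt => e e0.
apply/nbhs_shift; apply: filterS (np e e0) => v /= pv.
by rewrite (le_lt_trans (fp _ _))// addrC addKr.
Qed.

Lemma nbhs0_add (U : set E) : nbhs 0 U ->
  exists2 W : set E, nbhs 0 W & forall x y, W x -> W y -> U (x + y).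
Proof.
have := @add_continuous E (0, 0); rewrite /continuous_at /= addr0.
move=> /[apply] -[[A B] /= [A0 B0] AB].
exists (A `&` B); first exact: filterI.
by move=> x y [Ax _] [_ By]; exact: (AB (x, y)).
Qed.

Lemma nbhs0_absorbs (U : set E) x : nbhs 0 U ->
  exists2 e : R, 0 < e & forall t : R, `|t| <= e -> U (t *: x).
Proof.
have := @scale_continuous R E (0, x); rewrite /continuous_at /= scale0r.
move=> /[apply] -[[A B] /= [/nbhs_ballP[e /= e0 eA] B0] AB].
exists (e / 2); first by rewrite divr_gt0.
move=> t te; apply: (AB (t, x)); split => /=; last exact: nbhs_singleton.
apply: eA; rewrite -ball_normE /= sub0r normrN (le_lt_trans te)//.
by rewrite ltr_pdivrMr // ltr_pMr // ltr1n.
Qed.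

(** A compact set is closed in a Hausdorff space, so its complement is a neighbourhood of 0; joint
    continuity of scaling at [(0, 0)] does the rest. *)
Lemma nbhs0_avoid (F : set E) : hausdorff_space E -> compact F -> ~ F 0 ->
  exists e (W : set E), [/\ 0 < e, nbhs 0 W &
    forall (t : R) x, `|t| <= e -> W x -> ~ F (t *: x)].
Proof.
move=> hE cF F0; have cl : closed F by exact: compact_closed.
have nF : nbhs (0 : E) (~` F).
  by apply: open_nbhs_nbhs; split => //; exact: closed_openC.
have := @scale_continuous R E (0, 0); rewrite /continuous_at /= scale0r.
move=> /(_ _ nF) -[[A B] /= [/nbhs_ballP[e /= e0 eA] B0] AB].
exists (e / 2), B; split => //; first by rewrite divr_gt0.
move=> t x te Bx; apply: (AB (t, x)); split => //=.
apply: eA; rewrite -ball_normE /= sub0r normrN (le_lt_trans te)//.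
by rewrite ltr_pdivrMr // ltr_pMr // ltr1n.
Qed.

Definition seminorm (p : E -> R) : Prop :=
  (forall x y, p (x + y) <= p x + p y) /\ (forall a x, p (a *: x) = `|a| * p x).

Lemma seminorm_ge0 p x : seminorm p -> 0 <= p x.
Proof.
move=> [pD pZ]; have := pD x (- x).
rewrite addrN -scaleN1r pZ normrN1 -(scale0r x) pZ normr0; lra.
Qed.

Lemma nbhs0_seminorm p (e : R) : finest_lc_topology E -> seminorm p -> 0 < e ->
  nbhs 0 [set x | p x < e].
Proof.
move=> fE sp e0; have [pD pZ] := sp; have p0 x := seminorm_ge0 x sp.
apply: fE.
- apply/convex_setE => x y t t0 t1 /= px py.
  apply: (le_lt_trans (pD _ _)); rewrite !pZ !ger0_norm ?subr_ge0 //.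
  have [->|tn0] := eqVneq t 0; first lra.
  have : t * p x < t * e by rewrite ltr_pM2l // lt_def tn0.
  have : (1 - t) * p y <= (1 - t) * e by rewrite ler_wpM2l ?subr_ge0 // ltW.
  lra.
- move=> l x l1 /= px; rewrite pZ (le_lt_trans _ px)//.
  by rewrite ler_piMl.
(* The [+ 1] covers [p x = 0], and the factor 2 makes the final inequality strict. *)
- move=> x; exists (e / (2 * (p x + 1))).
    by rewrite divr_gt0 // mulr_gt0 // ltr_wpDl.
  move=> l le; rewrite /= pZ; have p1 : 0 < p x + 1 by rewrite ltr_wpDl.
  apply: (@le_lt_trans _ _ (e / (2 * (p x + 1)) * (p x + 1))).
    by apply: ler_pM => //; rewrite lerDl.
  rewrite invfM mulrA mulfVK ?gt_eqF //.
  by rewrite ltr_pdivrMr // ltr_pMr // ltr1n.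
Qed.

Section Hamel.
Context {I : choiceType} (H : hamel E I).

Lemma wsum_seminorm (w : I -> R) : (forall i, 0 <= w i) -> seminorm (wsum H w).
Proof. by move=> w0; split=> *; [exact: wsumD|exact: wsumZ]. Qed.

Lemma co_continuous i : finest_lc_topology E -> continuous (co H i : E -> R^o).
Proof.
move=> fE; apply: (@continuous_dominated (fun x => `|co H i x|)).
  move=> e e0; apply: nbhs0_seminorm => //; split=> [x y|a x].
    by rewrite coD ler_normD.
  by rewrite coZ normrM.
by move=> x y; rewrite coB distrC.
Qed.

(** If [A] contains [r i *: vec H i] for all [i], take the weights [(r i)^-1]: a vector of weighted
    sum below 1 is then an absolutely convex combination of these multiples. *)
Lemma finest_of_wsum :
  (forall w : I -> R, (forall i, 0 <= w i) ->
     nbhs 0 [set x | wsum H w x < 1]) ->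
  finest_lc_topology E.
Proof.
move=> nw A cA bA aA.
have /choice[r rP] : forall i, exists r : R, 0 < r /\ A (r *: vec H i).
  move=> i; have [r r0 rA] := aA (vec H i); exists r; split => //.
  by apply: rA; rewrite gtr0_norm.
have A0 : A 0.
  have [r1 r10 /(_ 0)] := aA 0; rewrite scale0r; apply.
  by rewrite normr0 ltW.
(* Convexity in homogeneous form, sA + tA inside (s + t)A, which suits induction on the number of
   terms. *)
have AD s t x y : 0 <= s -> 0 <= t -> A x -> A y ->
    exists2 z, A z & s *: x + t *: y = (s + t) *: z.
  move=> s0 t0 Ax Ay; have [st0|st0] := eqVneq (s + t) 0.
    exists 0 => //; have -> : s = 0 by lra.
    have -> : t = 0 by lra.
    by rewrite addr0 !scale0r addr0.
  have stp : 0 < s + t by rewrite lt_def st0 addr_ge0.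
  have l0 : 0 <= s / (s + t) by rewrite divr_ge0 // ltW.
  have l1 : s / (s + t) <= 1 by rewrite ler_pdivrMr // mul1r lerDl.
  exists (s / (s + t) *: x + (1 - s / (s + t)) *: y).
    exact: (convex_setE A).1.
  rewrite scalerDr !scalerA mulrCA divff // mulr1.
  by rewrite mulrBr mulr1 mulrCA divff // mulr1 (addrC s) addrK.
have Asum (s : seq I) (c : I -> R) : exists2 z, A z &
    \sum_(i <- s) c i *: vec H i = (\sum_(i <- s) (r i)^-1 * `|c i|) *: z.
  elim: s => [|i s [z Az ez]].
    by exists 0 => //; rewrite !big_nil scaler0.
  rewrite !big_cons ez; have [ri Ari] := rP i.
  have rip : r i != 0 by rewrite gt_eqF.
  (* The sign of the coefficient moves onto the vector, where balancedness absorbs it. *)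
  have -> : c i *: vec H i =
      ((r i)^-1 * `|c i|) *: (Num.sg (c i) *: (r i *: vec H i)).
    by rewrite !scalerA; congr (_ *: _); rewrite [LHS]numEsg; field.
  apply: AD => //.
  - by rewrite mulr_ge0 // invr_ge0 ltW.
  - apply: sumr_ge0 => j _.
    by rewrite mulr_ge0 // invr_ge0 ltW //; case: (rP j).
  - by apply: bA => //; rewrite normr_sg; case: (_ != 0); rewrite ?ler01.
have w0 i : 0 <= (r i)^-1 by rewrite invr_ge0 ltW //; case: (rP i).
apply: filterS (nw (fun i => (r i)^-1) w0) => x /= xw.
have [z Az] := Asum (supp H x) (co H ^~ x); rewrite -co_decomp => ->.
by apply: bA => //; rewrite ger0_norm ?wsum_ge0 // ltW.
Qed.

End Hamel.
End Tvs.

(** * Coordinate boxes and seminorms on finite-dimensional sets *)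

Lemma exists_max (T : eqType) (r : rel T) (s : seq T) :
  total r -> transitive r -> s != [::] ->
  exists2 m, m \in s & forall x, x \in s -> r x m.
Proof.
move=> tot tr; elim: s => // a s ih _; have [->|/ih[m ms mx]] := eqVneq s [::].
  exists a; first exact: mem_head.
  by move=> x; rewrite inE => /eqP ->; have /orP[] := tot a a.
have /orP[am|ma] := tot a m.
  exists m; first by rewrite inE ms orbT.
  by move=> x; rewrite inE => /predU1P[->|/mx].
exists a; first exact: mem_head.
move=> x; rewrite inE => /predU1P[->|/mx xm]; last exact: tr ma.
by have /orP[] := tot a a.
Qed.

Section Box.
Context {R : realType} {E : tvsType R} {I : choiceType} (H : hamel E I).

Lemma finite_dim_supp (A : set E) : finite_dim_set A ->
  exists2 s : seq I, uniq s & forall x i, A x -> co H i x != 0 -> i \in s.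
Proof.
move=> [l Al]; exists (undup (flatten (map (supp H) l))).
  exact: undup_uniq.
move=> x i /Al[c ->]; rewrite mem_undup co_sum.
apply: contraNT => il; rewrite big1 // => j _.
suff -> : co H i l`_j = 0 by rewrite mulr0.
apply/eqP; apply: contraNT il => /mem_supp ij.
apply/flattenP; exists (supp H l`_j) => //.
by apply: map_f; rewrite mem_nth.
Qed.

Lemma finite_dim_of_supp (A : set E) (s : seq I) : uniq s ->
  (forall x i, A x -> co H i x != 0 -> i \in s) -> finite_dim_set A.
Proof.
move=> us As; exists (map (vec H) s) => x Ax.
exists (nth 0 (map (co H ^~ x) s)); rewrite size_map.
rewrite [LHS](decomp_supp us (As x ^~ Ax)) big_tnth.
apply: eq_bigr => k _; have ks : (k < size s)%N := ltn_ord k.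
by rewrite (tnth_nth (tnth (in_tuple s) k)) !(nth_map (tnth (in_tuple s) k)).
Qed.

(** The bound 0 outside [s] forces the box into the span of the vectors indexed by [s]. *)
Definition box (d : I -> R) (s : seq I) : set E :=
  [set x | forall i, `|co H i x| <= if i \in s then d i else 0].

Lemma box_nil d : box d [::] = [set 0].
Proof.
apply/seteqP; split=> [x x0|_ -> i]; last by rewrite co0 normr0.
by apply: (co_eq0 (H := H)) => i; apply/eqP; rewrite -normr_le0; exact: x0.
Qed.

(** Writing a box as a continuous image of a smaller box times a segment gives its compactness by
    induction. *)
Lemma box_cons d i s : i \notin s ->
  box d (i :: s) = (fun xt : E * R^o => xt.1 + xt.2 *: vec H i) @`
    (box d s `*` [set` `[- d i, d i]]).
Proof.
move=> is_; apply/seteqP; split.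
  move=> x xb; exists (x - co H i x *: vec H i, co H i x) => /=; last first.
    by rewrite subrK.
  split => /=; last first.
    by have := xb i; rewrite mem_head in_itv /= ler_norml.
  move=> j; rewrite coB coZ co_vec; case: eqP => [->|/eqP ji].
    by rewrite mulr1 subrr normr0 (negPf is_).
  by rewrite mulr0 subr0; have := xb j; rewrite inE (negPf ji).
move=> _ [[x t] [/= xb tb] <-] j; rewrite coD coZ co_vec inE.
case: eqP => [->|ji] /=; last by rewrite mulr0 addr0; exact: xb.
have := xb i; rewrite (negPf is_) normr_le0 => /eqP ->.
by rewrite add0r mulr1 ler_norml; move: tb; rewrite in_itv.
Qed.

Lemma compact_box d s : uniq s -> compact (box d s).
Proof.
elim: s => [_|i s ih /= /andP[is_ us]].
  by rewrite box_nil; exact: compact_set1.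
rewrite (box_cons d is_); apply: continuous_compact.
  by apply: continuous_subspaceT; exact: continuous_addl_scale.
by apply: compact_setX; [exact: ih|exact: (@segment_compact R)].
Qed.

(* The sphere of the sup-norm on the span of [s] is, up to sign, the union of
   the compact faces [vec j + box 1 (s \ j)], which avoid 0; a neighbourhood of 0
   whose small multiples miss these faces has bounded coordinates. *)
Lemma co_bounded_near0 s : hausdorff_space E -> uniq s ->
  exists C (W : set E), [/\ 0 < C, nbhs 0 W & forall x, W x ->
    (forall i, co H i x != 0 -> i \in s) -> forall i, `|co H i x| <= C].
Proof.
move=> hE us.
pose face j : set E := (fun x : E => vec H j + x) @` box (fun=> 1) (rem j s).
pose F := \big[setU/set0]_(j <- s) face j.
have FE x : F x <-> exists2 j, j \in s & face j x.
  rewrite /F -bigcup_seq; split=> [[j /= ? ?]|[j ? ?]]; by exists j.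
have cF : compact F.
  apply: bigsetU_compact => j _; apply: continuous_compact.
    by apply: continuous_subspaceT; exact: continuous_addr.
  by apply: compact_box; exact: rem_uniq.
have F0 : ~ F 0.
  move=> /FE[j js [x xb]] /(congr1 (co H j)); rewrite coD co_vec eqxx co0.
  have := xb j; rewrite mem_rem_uniq // inE eqxx /= normr_le0 => /eqP ->.
  by rewrite addr0 => /eqP; rewrite oner_eq0.
have [e [W [e0 W0 WF]]] := nbhs0_avoid hE cF F0.
exists e^-1, W; split; rewrite ?invr_gt0 // => x Wx xs i.
rewrite leNgt; apply/negP => ei.
have is_ : i \in s.
  by apply: xs; rewrite -normr_gt0; apply: lt_trans ei; rewrite invr_gt0.
have [|||j js jm] := @exists_max I (fun j k => `|co H j x| <= `|co H k x|) s.
- by move=> j k; exact: le_total.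
- by move=> j k l; exact: le_trans.
- by case: (s) is_.
have ej : e^-1 < `|co H j x| by apply: lt_le_trans ei _; exact: jm.
have j0 : 0 < `|co H j x| by apply: lt_trans ej; rewrite invr_gt0.
apply: (WF (co H j x)^-1 x) => //.
  by rewrite normfV -[leRHS]invrK lef_pV2 ?posrE ?invr_gt0 // ltW.
apply/FE; exists j => //; exists ((co H j x)^-1 *: x - vec H j); last first.
  by rewrite addrC subrK.
move=> k; rewrite coB coZ co_vec mem_rem_uniq // inE.
have [->|kj] := eqVneq k j.
  by rewrite mulVf -?normr_gt0 // subrr normr0.
rewrite subr0 /=; case: ifPn => ks.
  by rewrite normrM normfV ler_pdivrMl // mulr1 jm.
by have [->|/xs] := eqVneq (co H k x) 0; rewrite ?mulr0 ?normr0 // (negPf ks).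
Qed.

Lemma wsum_small_near0 (w : I -> R) s (e : R) : hausdorff_space E -> uniq s ->
  (forall i, 0 <= w i) -> 0 < e -> \forall x \near (0 : E),
    (forall i, co H i x != 0 -> i \in s) -> wsum H w x < e.
Proof.
move=> hE us w0 e0; have [C [W [C0 W0 WC]]] := co_bounded_near0 hE us.
pose S := \sum_(i <- s) w i; have S0 : 0 <= S by exact: sumr_ge0.
have S1 : 0 < S + 1 by lra.
(* On the vectors of [W] supported in [s] the weighted sum is at most [S * C], so shrinking [W] by
   [d] brings it below [e]; the [+ 1] allows [S = 0]. *)
pose d := e / (C * (S + 1)); have d0 : 0 < d by rewrite divr_gt0 ?mulr_gt0.
have := nbhs0Z (lt0r_neq0 d0) W0; apply: filterS => _ [x Wx <-] xs.
have {}xs i : co H i x != 0 -> i \in s.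
  by move=> xi; apply: xs; rewrite coZ mulf_neq0 // gt_eqF.
rewrite wsumZ gtr0_norm // (wsumE w us xs).
have : \sum_(i <- s) w i * `|co H i x| <= S * C.
  by rewrite mulr_suml; apply: ler_sum => i _; rewrite ler_wpM2l // WC.
rewrite -(ler_pM2l d0) => /le_lt_trans; apply.
rewrite /d mulrAC ltr_pdivrMr ?mulr_gt0 // ltr_pM2l //.
by rewrite mulrDr mulr1 mulrC ltrDl.
Qed.

(** Differences of points of [K] are supported in one finite list, so smallness near 0 and the
    reverse triangle inequality suffice. *)
Lemma wsum_continuous_finite_dim (w : I -> R) (K : set E) : hausdorff_space E ->
  (forall i, 0 <= w i) -> finite_dim_set K ->
  {within K, continuous (wsum H w : E -> R^o)}.
Proof.
move=> hE w0 /finite_dim_supp[s us Ks].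
apply/subspace_continuousP => x Kx; apply/cvgrPdist_lt => e e0.
rewrite near_withinE; apply/nbhs_shift.
have [pD pZ] := wsum_seminorm H w0.
have := wsum_small_near0 hE us w0 e0; apply: filterS => v /= ve Kxv.
apply: le_lt_trans (ve _); last first.
  move=> i vi; have [xi|/(Ks _ _ Kx)//] := eqVneq (co H i x) 0.
  by apply: (Ks _ _ Kxv); rewrite coD xi add0r.
have := pD (x + v) (- v); rewrite addrK -scaleN1r pZ normrN1 mul1r => h1.
have h2 := pD x v; rewrite /from_subspace ler_norml; lra.
Qed.

Lemma finest_of_kR : hausdorff_space E -> @kR_space R E ->
  (forall K : set E, compact K -> ~ infinite_dim_set K) -> finest_lc_topology E.
Proof.
move=> hE kR cK; apply: (finest_of_wsum (H := H)) => w w0.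
have /(_ 0) := kR (wsum H w) (fun K cptK =>
  wsum_continuous_finite_dim hE w0 (contrapT (cK K cptK))).
move=> /cvgrPdist_lt/(_ _ ltr01); apply: filterS => x /=.
have [_ pZ] := wsum_seminorm H w0.
rewrite -(scale0r 0) pZ normr0 mul0r sub0r normrN ger0_norm //.
exact: wsum_ge0.
Qed.

End Box.

(** * Countable bases and transport along isomorphisms *)

Lemma hamel_of_seq (R : realType) (E : lmodType R) (b : nat -> E) :
  lin_indep_seq b -> spanning_seq b -> inhabited (hamel E nat).
Proof.
move=> ib sb; have [||H _] := @hamel_of_basis R E nat b; last by exists.
- move=> s c us s0 i is_; pose n := (\max_(j <- s) j).+1.
  have sn j : j \in s -> (j < n)%N by move=> js; rewrite ltnS leq_bigmax_seq.
  have := ib n (fun j => if j \in s then c j else 0).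
  rewrite -(big_mkord predT (fun j => (if j \in s then c j else 0) *: b j)).
  rewrite -sum_widen ?iota_uniq // => [/(_ s0 i (sn i is_))|j js].
    by rewrite is_.
  by rewrite mem_index_iota sn.
- move=> x; have [n [c ->]] := sb x; exists (index_iota 0 n), c.
  by rewrite iota_uniq big_mkord.
Qed.

Lemma seq_of_hamel (R : realType) (E : lmodType R) (H : hamel E nat) :
  lin_indep_seq (vec H) /\ spanning_seq (vec H).
Proof.
split=> [n c s0 i ni|x].
  have := congr1 (co H i) s0; rewrite co0 co_sum.
  rewrite (bigD1 (Ordinal ni)) //= co_vec eqxx mulr1 big1 ?addr0 // => j ji.
  rewrite co_vec; case: eqP => [ij|]; last by rewrite mulr0.
  by case/negP: ji; apply/eqP/val_inj.
pose n := (\max_(j <- supp H x) j).+1.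
exists n, (co H ^~ x).
rewrite -(big_mkord predT (fun i => co H i x *: vec H i)).
apply: decomp_supp; first exact: iota_uniq.
by move=> i /mem_supp ix; rewrite mem_index_iota ltnS leq_bigmax_seq.
Qed.

(** The basis is carried back by the inverse [g]. An absolutely convex absorbing [A] has such a
    preimage under [g], and continuity of [f] turns that neighbourhood in [V] into one in [E]. *)
Lemma is_phi_top_isomorphic (R : realType) (E V : tvsType R) :
  is_phi V -> top_isomorphic E V -> is_phi E.
Proof.
move=> [[b [ib sb]] fV] [f [flin fcont [g [fK gK] _]]].
have f0 : f 0 = 0.
  have := flin (-1) 0 0; rewrite scaler0 addr0 scaleN1r => ->.
  by rewrite addNr.
have fZ a x : f (a *: x) = a *: f x by rewrite -[a *: x]addr0 flin f0 addr0.
have gsum n (c : nat -> R) :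
    f (\sum_(i < n) c i *: g (b i)) = \sum_(i < n) c i *: b i.
  elim: n => [|n ih]; first by rewrite !big_ord0.
  by rewrite !big_ord_recr /= [in LHS]addrC flin gK ih addrC.
split.
  exists (g \o b); split=> [n c s0|x].
    by apply: ib; rewrite -gsum; rewrite /= in s0; rewrite s0.
  have [n [c e]] := sb (f x); exists n, c.
  by apply: (can_inj fK); rewrite /= gsum.
move=> A cA bA aA.
have cgA : convex_set ((g @^-1` A) : set (convex_lmodType V)).
  apply/convex_setE => x y t t0 t1 /= Ax Ay.
  have -> : t *: x + (1 - t) *: y = f (t *: g x + (1 - t) *: g y).
    by rewrite flin fZ !gK.
  by rewrite fK; exact: (convex_setE A).1.
have gZ l x : g (l *: x) = l *: g x by rewrite -{1}(gK x) -fZ fK.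
have nA : nbhs 0 (g @^-1` A).
  refine (fV _ cgA _ _) => [l x l1 /= Ax|x]; first by rewrite gZ; exact: bA.
  by have [r r0 rA] := aA (g x); exists r => // l lr; rewrite /= gZ; exact: rA.
have : nbhs (0 : E) (f @^-1` (g @^-1` A)) by apply: fcont; rewrite f0.
by rewrite -comp_preimage (_ : g \o f = id) //; apply/funext => x /=.
Qed.

(** * Compact sets and the k_R property for the finest topology *)

Section Phi.
Context {R : realType} {E : tvsType R} (H : hamel E nat).

Lemma phi_infinite_dimensional : infinite_dimensional E.
Proof.
move=> /(finite_dim_supp H)[s _ sE]; pose n := (\max_(j <- s) j).+1.
have : n \in s by apply: (sE (vec H n)); rewrite // co_vec eqxx oner_neq0.
by move=> /leq_bigmax_seq => /(_ xpredT id isT); rewrite /n ltnn.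
Qed.

Hypothesis fE : finest_lc_topology E.

Lemma phi_compact (K : set E) : compact K -> finite_dim_set K.
Proof.
move=> cK; apply: contrapT => infK.
(* If this failed for some [n], [K] would lie in the span of the first [n] basis vectors. *)
have /choice[xm xmP] : forall n, exists xm : E * nat,
    [/\ K xm.1, (n <= xm.2)%N & co H xm.2 xm.1 != 0].
  move=> n; apply: contrapT => nx; apply: infK.
  apply: (finite_dim_of_supp (H := H) (s := iota 0 n)); first exact: iota_uniq.
  move=> x i Kx xi; rewrite mem_iota leq0n add0n andTb ltnNge; apply/negP => ni.
  by apply: nx; exists (x, i).
(* Since [n <= (xm n).2], the weight at the index [(xm n).2] contains the [n]-th term, so the
   seminorm is at least [n] at the point [(xm n).1]. *)
pose w i : R := \sum_(n < i.+1) n%:R / `|co H i (xm n).1|.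
have w0 i : 0 <= w i by apply: sumr_ge0 => n _; rewrite divr_ge0.
have cw : continuous (wsum H w : E -> R^o).
  have sw := wsum_seminorm H w0; have [pD pZ] := sw.
  apply: (@continuous_dominated _ _ (wsum H w)) => [e|x y].
    exact: nbhs0_seminorm.
  have h1 := pD x (y - x); rewrite addrC subrK in h1.
  have := pD y (x - y); rewrite addrC subrK -opprB -scaleN1r pZ normrN1 mul1r.
  by rewrite ler_norml; lra.
have [M [_ MK]] := compact_bounded (continuous_compact
  (continuous_subspaceT cw) cK).
pose n := Num.bound (`|M| + 1).
have Mn : `|M| + 1 < n%:R by apply: archi_boundP; rewrite addr_ge0.
have [Kx nm cm] := xmP n.
have : `|wsum H w (xm n).1| <= `|M| + 1.
  by apply: MK; [rewrite (le_lt_trans (ler_norm _)) ?ltrDl|exists (xm n).1].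
rewrite ger0_norm ?wsum_ge0 // leNgt => /negP; apply.
apply: lt_le_trans Mn (le_trans _ (wsum_ge H _ (xm n).2 w0)).
rewrite -ler_pdivrMr ?normr_gt0 // /w (bigD1 (inord n)) //= inordK //.
by rewrite lerDl; apply: sumr_ge0 => j _; rewrite divr_ge0.
Qed.

Section KR.
Variables (f : E -> R^o) (x0 : E) (e : R).
Hypothesis fK : forall K : set E, compact K -> {within K, continuous f}.

Definition close_on (A : set E) := forall v, A v -> `|f x0 - f (x0 + v)| < e.

Definition upd (d : nat -> R) i t := fun j => if j == i then t else d j.

Lemma box_upd d i t s : i \notin s -> box H (upd d i t) s = box H d s.
Proof.
move=> is_; rewrite /box; apply/seteqP; split=> x xb j; have := xb j;
by case: ifPn => // js; rewrite /upd; case: eqP => // ji; rewrite -ji js in is_.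
Qed.

(** Tube lemma: each point of the compact box tolerates a small move along [vec H i], and
    compactness makes the allowed size uniform. *)
Lemma close_on_step d i s : uniq (i :: s) -> close_on (box H d s) ->
  exists2 t, 0 < t & close_on (box H (upd d i t) (i :: s)).
Proof.
move=> /[dup] uis /= /andP[is_ us] ds.
pose shift : E -> E := +%R x0.
have cs : continuous shift by exact: continuous_addr.
(* One compact set, with side 1 in direction [i], contains every point compared below; [f] is
   continuous on it. *)
pose K := shift @` box H (upd d i 1) (i :: s).
have cK : compact K.
  apply: continuous_compact; first exact: continuous_subspaceT.
  exact: compact_box.
have KE u t : box H d s u -> `|t| <= 1 -> K (x0 + (u + t *: vec H i)).
  move=> us_ t1; exists (u + t *: vec H i) => //.
  rewrite box_cons // box_upd //.
  exists (u, t) => //; split => //=; rewrite in_itv /= /upd eqxx.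
  by rewrite -ler_norml.
have := fK cK; rewrite subspace_continuousP => fc.
have /compact_near_coveringP cb := compact_box (H := H) (d := d) us.
pose P (t : R^o) u := box H d s u -> `|t| <= 1 ->
  `|f x0 - f (x0 + (u + t *: vec H i))| < e.
have cbP := cb _ (nbhs (0 : R^o)) P _.
have Pn u : box H d s u -> \forall u' \near u & t \near (0 : R^o), P t u'.
  move=> bu; have Ku : K (x0 + u).
    by have := KE u 0 bu; rewrite normr0 scale0r addr0; apply.
  have := fc _ Ku => /cvgrPdist_lt; have eu := ds u bu.
  (* The tolerance is the slack left at [u] by the strict bound on the old box. *)
  move=> /(_ (e - `|f x0 - f (x0 + u)|)); rewrite subr_gt0 => /(_ eu).
  rewrite near_withinE -[in X in nbhs X](addr0 u) -(scale0r (vec H i)) => nu.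
  have cont := @continuous_comp _ _ _
    (fun xt : E * R^o => xt.1 + xt.2 *: vec H i) shift (u, 0)
    (@continuous_addl_scale _ _ (vec H i) (u, 0)) (@cs _).
  have : nbhs (u, 0 : R^o)
    ((fun xt : E * R^o => x0 + (xt.1 + xt.2 *: vec H i)) @^-1`
     [set y | K y -> `|f (x0 + u) - f y| < e - `|f x0 - f (x0 + u)|]).
    exact: (cont _ nu).
  apply: filterS => -[u' t] /= h bu' t1.
  have := h (KE _ _ bu' t1).
  have := ler_distD (f (x0 + u)) (f x0) (f (x0 + (u' + t *: vec H i))).
  rewrite /shift; lra.
have [r /= r0 rP] := (nbhs_ballP (0 : R^o) _).1 (cbP _ Pn).
(* The bound 1 keeps the points in [K], and [r / 2] turns the closed interval into part of the open
   ball. *)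
exists (Num.min 1 (r / 2)); first by rewrite lt_min ltr01 divr_gt0.
move=> v; rewrite box_cons // box_upd // => -[[u t] /= [bu]].
rewrite /upd eqxx in_itv /= -ler_norml le_min => /andP[t1 tr] <-.
apply: (rP t) => //; rewrite -ball_normE /= sub0r normrN (le_lt_trans tr) //.
by rewrite ltr_pdivrMr // ltr_pMr // ltr1n.
Qed.

Lemma near_close : 0 < e -> \forall v \near (0 : E), `|f x0 - f (x0 + v)| < e.
Proof.
(* Reversing the list puts the new index [n] at the head of [s n.+1], as the step lemma expects. *)
move=> e0; pose s n := rev (iota 0 n).
have sS n : s n.+1 = n :: s n by rewrite /s -addn1 iotaD rev_cat.
have us n : uniq (s n) by rewrite rev_uniq iota_uniq.
(* [T] selects the next half-width from all earlier ones; 0 is a default for boxes on which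
   closeness already fails. *)
have /choice[T TP] : forall dn : (nat -> R) * nat, exists t,
    close_on (box H dn.1 (s dn.2)) ->
    0 < t /\ close_on (box H (upd dn.1 dn.2 t) (s dn.2.+1)).
  move=> [d n] /=; have [cd|ncd] := pselect (close_on (box H d (s n))).
    have := us n.+1; rewrite sS => /close_on_step/(_ cd)[t t0 ct].
    by exists t.
  by exists 0.
pose D := fix D n := if n is m.+1 then upd (D m) m (T (D m, m)) else fun=> 0.
have DP n : close_on (box H (D n) (s n)).
  elim: n => [|n ih]; last by have [] := TP (D n, n) ih.
  by rewrite /s /= box_nil => _ ->; rewrite addr0 subrr normr0.
pose d n := T (D n, n).
have d0 n : 0 < d n by have [] := TP (D n, n) (DP n).
have dD n i : (i < n)%N -> D n i = d i.
  elim: n => // n ih; rewrite ltnS leq_eqVlt /= /upd => /predU1P[->|in_].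
    by rewrite eqxx.
  by rewrite ltn_eqF // ih.
have w0 i : 0 <= (d i)^-1 by rewrite invr_ge0 ltW.
(* With weights [(d i)^-1], a weighted sum below 1 bounds each coordinate by [d i], so [v] lies in
   the box given by its finite support. *)
have := nbhs0_seminorm fE (wsum_seminorm H w0) ltr01.
apply: filterS => v /= wv; pose n := (\max_(j <- supp H v) j).+1.
apply: (DP n) => i; rewrite mem_rev mem_iota leq0n add0n andTb.
case: ltnP => ni.
  rewrite dD // -[d i]mulr1 -ler_pdivrMl //.
  exact: le_trans (wsum_ge H v i w0) (ltW wv).
rewrite normr_le0; apply: contraLR ni => /mem_supp iv.
by rewrite -ltnNge /n ltnS leq_bigmax_seq.
Qed.

End KR.

Lemma phi_kR : @kR_space R E.
Proof.
move=> f fK x; apply/cvgrPdist_lt => e e0; apply/nbhs_shift.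
exact: near_close.
Qed.

End Phi.

(** * Well-orders and the existence of Hamel bases *)

(** Unique least elements yield the order axioms: pairs give totality and antisymmetry, triples give
    transitivity. *)
Lemma exists_well_order (T : eqType) : exists r : rel T,
  [/\ antisymmetric r, transitive r, total r &
   forall P : T -> Prop, (exists x, P x) ->
     exists2 m, P m & forall x, P x -> r m x].
Proof.
have [r wo] := wochoice.well_ordering_principle T.
have min (P : T -> Prop) : (exists x, P x) ->
    exists2 m, P m & forall x, P x -> r m x.
  move=> [x Px]; have [|m [[Pm mP] _]] := wo [pred x | `[< P x >]].
    by exists x; exact/asboolP.
  exists m; first exact/asboolP.
  by move=> y Py; apply: mP; exact/asboolP.
have tot : total r.
  move=> x y; have [|m [] -> h] := min (fun z => z = x \/ z = y).
  - by exists x; left.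
  - by rewrite h //; right.
  - by rewrite (h x) ?orbT //; left.
have anti : antisymmetric r.
  move=> x y /andP[xy yx].
  have [|m [_ u]] := wo [pred z | (z == x) || (z == y)].
    by exists x; rewrite inE eqxx.
  have refl z : r z z by have /orP[] := tot z z.
  have mx : m = x.
    by apply: u; split=> [|z /orP[]/eqP ->]; rewrite ?inE ?eqxx.
  have my : m = y.
    by apply: u; split=> [|z /orP[]/eqP ->]; rewrite ?inE ?eqxx ?orbT.
  by rewrite -mx -my.
exists r; split=> // y x z xy yz.
have [|m mp h] := min (fun t => [\/ t = x, t = y | t = z]).
  by exists x; constructor 1.
have [hx hy hz] : [/\ r m x, r m y & r m z].
  by split; apply: h; [constructor 1|constructor 2|constructor 3].
case: mp => e; subst m => //.
- by rewrite (anti x y) // xy hx.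
- by rewrite -(anti y z) // yz hy.
Qed.

(* The basis consists of the vectors that are not combinations of vectors
   strictly below them in a well-order of [E]. *)
Lemma exists_hamel (R : realType) (E : lmodType R) :
  exists I : choiceType, inhabited (hamel E I).
Proof.
have [r [anti tr tot min]] := exists_well_order E.
pose below x : Prop := exists s : seq (R * E),
  (forall p, p \in s -> r p.2 x /\ p.2 <> x) /\ x = \sum_(p <- s) p.1 *: p.2.
pose I : choiceType := {x : E | `[< ~ below x >]}.
have [||H _] := @hamel_of_basis R E I val; last by exists I; exists.
- move=> s c us s0 i is_; apply/eqP/negP => /negP ci.
  pose s' := [seq j <- s | c j != 0].
  have us' : uniq s' by exact: filter_uniq.
  (* In a nontrivial relation, the largest vector with nonzero coefficient would be a combination of
     strictly smaller ones. *)
  have [|||m ms mmax] := @exists_max I (fun j k => r (val j) (val k)) s'.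
  + by move=> j k; exact: tot.
  + by move=> j k l; exact: tr.
  + apply/eqP => s'0; have : i \in s' by rewrite mem_filter ci.
    by rewrite s'0.
  have cm : c m != 0 by move: ms; rewrite mem_filter => /andP[].
  have /asboolP := valP m; apply.
  exists [seq (- (c j / c m), val j) | j <- rem m s']; split.
    move=> _ /mapP[j + ->] /=; rewrite mem_rem_uniq // inE => /andP[jm js].
    by split; [exact: mmax|move=> /val_inj e; rewrite e eqxx in jm].
  rewrite big_map /=; apply: (scalerI cm); rewrite scaler_sumr.
  have : \sum_(j <- s') c j *: val j = 0.
    rewrite -[RHS]s0; apply/esym/big_seq_subset => //.
      by move=> j; rewrite mem_filter => /andP[].
    move=> j js; rewrite mem_filter js andbT negbK => /eqP ->.
    by rewrite scale0r.
  rewrite (big_rem m ms) /= => /eqP; rewrite addr_eq0 => /eqP ->.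
  rewrite -sumrN; apply: eq_bigr => j _.
  by rewrite scalerA -scaleNr; congr (_ *: _); field.
- move=> x; apply: contrapT => nx.
  (* A least unspanned vector is either a basis vector or a combination of smaller vectors, all
     spanned; both are absurd. *)
  have [|m nm mmin] := min (fun x => ~ spanned (val : I -> E) x).
    by exists x.
  have [[s [sm ms]]|nb] := pselect (below m); last first.
    have /asboolP bm := nb; apply: nm.
    exact: (spanned_vec _ (exist _ m bm : I)).
  apply: nm; rewrite ms; apply: spanned_sum => p /sm[pm pnm].
  apply: contrapT => /mmin mp; apply: pnm.
  by apply: anti; rewrite pm mp.
Qed.

Lemma hamel_reindex (R : realType) (E : lmodType R) (I J : choiceType)
    (h : J -> I) : bijective h -> hamel E I -> inhabited (hamel E J).
Proof.
move=> [h' hK h'K] H; exists.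
refine (@Hamel R E J (vec H \o h) (fun j => co H (h j))
  (fun x => map h' (supp H x)) _ _ _ _).
- by move=> x; rewrite map_inj_uniq ?supp_uniq //; exact: can_inj h'K.
- by move=> j a x y; exact: co_lin.
- by move=> i j; rewrite /= co_vec (can_eq hK).
- move=> x; rewrite big_map [LHS](co_decomp H).
  by apply: eq_bigr => i _; rewrite /= h'K.
Qed.

(** * Excluding uncountable bases *)

(** A least element outside [J] would have all its predecessors in the countable set [J], hence
    would belong to [J]. *)
Lemma countable_of_initial_segments (T : eqType) (r : rel T) :
  (forall P : T -> Prop, (exists x, P x) ->
     exists2 m, P m & forall x, P x -> r m x) ->
  antisymmetric r ->
  let J := [set i | countable [set j | r j i /\ j <> i]] in
  countable J -> countable [set: T].
Proof.
move=> min anti J cJ.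
suff -> : [set: T] = J by [].
apply/seteqP; split=> // i _; apply: contrapT => niJ.
have [|m nm mmin] := min (fun i => ~ J i); first by exists i.
apply: nm; apply: sub_countable cJ; apply: subset_card_le => j /= [jm ne].
apply: contrapT => /mmin mj; apply: ne; apply: anti; by rewrite jm mj.
Qed.

Section Uncountable.
Context {R : realType} {E : tvsType R} {I : choiceType} (H : hamel E I).

Definition pair_sum (g : I -> I -> R) (x : E) : R :=
  \sum_(i <- supp H x) \sum_(j <- supp H x) g i j * `|co H i x| * `|co H j x|.

Lemma pair_sumE g x s : uniq s -> (forall i, co H i x != 0 -> i \in s) ->
  pair_sum g x =
  \sum_(i <- s) \sum_(j <- s) g i j * `|co H i x| * `|co H j x|.
Proof.
move=> us xs; rewrite /pair_sum (@sum_supp _ _ _ H _ _ x s) //; last first.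
  by move=> i xi; apply: big1 => j _; rewrite xi normr0 mulr0 mul0r.
apply: eq_bigr => i _; apply: sum_supp => // j xj.
by rewrite xj normr0 mulr0.
Qed.

Lemma pair_sum_ge g x i j : (forall i j, 0 <= g i j) ->
  g i j * `|co H i x| * `|co H j x| <= pair_sum g x.
Proof.
move=> g0; have g0' k l : 0 <= g k l * `|co H k x| * `|co H l x|.
  by rewrite !mulr_ge0.
have p0 s : 0 <= \sum_(k <- s) \sum_(l <- supp H x)
    g k l * `|co H k x| * `|co H l x|.
  by apply: sumr_ge0 => k _; exact: sumr_ge0.
have [xi|/mem_supp xi] := eqVneq (co H i x) 0.
  by rewrite xi normr0 mulr0 mul0r p0.
have [xj|/mem_supp xj] := eqVneq (co H j x) 0.
  by rewrite xj normr0 mulr0 p0.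
rewrite /pair_sum (big_rem i xi) /= (big_rem j xj) /= -addrA lerDl.
by apply: addr_ge0; [apply: sumr_ge0 => k _; exact: g0'|exact: p0].
Qed.

(** On [K] the sum runs over one fixed finite list, so it is a polynomial in absolute values of
    continuous coordinates. *)
Lemma pair_sum_within g (K : set E) : finest_lc_topology E ->
  finite_dim_set K -> {within K, continuous (pair_sum g : E -> R^o)}.
Proof.
move=> fE /(finite_dim_supp H)[s us Ks].
apply: (@subspace_eq_continuous _ K _ (fun x : E =>
  \sum_(i <- s) \sum_(j <- s) g i j * `|co H i x| * `|co H j x| : R^o)).
  move=> x; rewrite inE => Kx; rewrite /from_subspace (pair_sumE g us) //.
  by move=> i; exact: Ks.
apply: continuous_subspaceT.
apply: (@continuous_big _ _ _ _ predT (@add_continuous R^o)) => i _.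
apply: (@continuous_big _ _ _ _ predT (@add_continuous R^o)) => j _ x.
apply: (@cvgM R); last by apply: (@cvg_norm R R^o); exact: co_continuous.
apply: (@cvgM R); first exact: cvg_cst.
by apply: (@cvg_norm R R^o); exact: co_continuous.
Qed.

Lemma countable_of_kR : finest_lc_topology E -> @kR_space R E ->
  (forall K : set E, compact K -> ~ infinite_dim_set K) ->
  countable [set: I].
Proof.
move=> fE kR cK; have [r [anti tr tot min]] := exists_well_order I.
apply: (countable_of_initial_segments min anti).
set J := [set i | _].
have /choice[h hP] : forall i, exists h : I -> nat, J i ->
    {in [set j | r j i /\ j <> i] &, injective h}.
  move=> i; have [/countable_injP[h hi]|ni] := pselect (J i); first by exists h.
  by exists (fun=> 0%N).
pose g i j : R := (h i j)%:R.
have g0 i j : 0 <= g i j by exact: ler0n.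
have fc := kR (pair_sum g) (fun K cptK =>
  pair_sum_within (g := g) fE (contrapT (cK K cptK))).
have U0 : nbhs 0 [set x | pair_sum g x < 1].
  have /cvgrPdist_lt/(_ _ ltr01) := fc 0; apply: filterS => x /=.
  have -> : pair_sum g 0 = 0.
    by rewrite (@pair_sumE _ _ [::]) ?big_nil // => i; rewrite co0 eqxx.
  by rewrite sub0r normrN; exact: le_lt_trans (ler_norm _).
(* Multiples [e i *: vec H i] taken in [W] have pairwise sums in the set where [pair_sum] is below
   1, which bounds each product [g i j * e i * e j]. *)
have [W W0 WU] := nbhs0_add U0.
have /choice[e eP] : forall i, exists e : R, 0 < e /\ W (e *: vec H i).
  move=> i; have [e e0 eW] := nbhs0_absorbs (vec H i) W0; exists e; split => //.
  by apply: eW; rewrite gtr0_norm.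
have e0 i : 0 < e i by case: (eP i).
have gle i j : i <> j -> g i j * e i * e j < 1.
  move=> ij; apply: le_lt_trans (WU _ _ (eP i).2 (eP j).2).
  have := pair_sum_ge (e i *: vec H i + e j *: vec H j) i j g0.
  move/eqP/negPf: ij => ij; rewrite !coD !coZ !co_vec !eqxx [j == i]eq_sym ij.
  by rewrite !mulr0 !mulr1 addr0 add0r !gtr0_norm.
pose S m := [set i | J i /\ (e i)^-1 <= m%:R].
have -> : J = \bigcup_m S m.
  apply/seteqP; split=> [i Ji|i [m _ []//]].
  exists (Num.bound (e i)^-1) => //; split => //.
  by apply/ltW/archi_boundP; rewrite invr_ge0 ltW.
apply: bigcup_countable => // m _; apply: finite_set_countable.
(* One element is spent on the maximum [M]; the other [m * m + 1] or more are predecessors of [M],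
   sent injectively by [h M] into the naturals below [m * m]. *)
apply: contrapT => /(@infinite_set_fset _ _ (m * m).+2)[B0 B0S B0m].
have [B [uB BS Bm]] : exists B : seq I, [/\ uniq B,
    forall i, i \in B -> S m i & ((m * m).+1 < size B)%N].
  exists (finmap.enum_fset B0); split => //; exact: finmap.fset_uniq.
have [|M MB Mmax] := @exists_max I r B tot tr.
  by apply/eqP => B1; rewrite B1 in Bm.
have [JM eM] := BS M MB.
pose L := map (h M) (rem M B).
have Mseg j : j \in rem M B -> [/\ r j M, j <> M & S m j].
  rewrite mem_rem_uniq // inE => /andP[/eqP jM jB].
  by split => //; [exact: Mmax|exact: BS].
have uL : uniq L.
  rewrite map_inj_in_uniq ?rem_uniq // => j k /Mseg[j1 j2 _].
  by move=> /Mseg[k1 k2 _]; apply: (hP M JM); rewrite inE.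
have : (size L <= size (iota 0 (m * m)))%N.
  apply: uniq_leq_size => // _ /mapP[j /Mseg[_ jM [_ ej]] ->].
  rewrite mem_iota leq0n add0n andTb -(ltr_nat R) natrM.
  have /gle : M <> j by apply/nesym.
  rewrite -mulrA -ltr_pdivlMr ?mulr_gt0 // => /lt_le_trans; apply.
  by rewrite mul1r invfM ler_pM // invr_ge0 ltW.
rewrite size_iota size_map size_rem // leqNgt => /negP; apply.
by rewrite -ltnS prednK //; exact: leq_trans Bm.
Qed.

End Uncountable.

(** * Assembling the two implications *)

Lemma is_phi_of_kR (R : realType) (E : tvsType R) : hausdorff_space E ->
  infinite_dimensional E -> @kR_space R E ->
  (forall K : set E, compact K -> ~ infinite_dim_set K) -> is_phi E.
Proof.
move=> hE infE kR cK; have [I [H]] := exists_hamel E.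
have fE := finest_of_kR H hE kR cK; split => //.
have cI : countable [set: I] by exact: countable_of_kR H fE kR cK.
have iI : infinite_set [set: I].
  move=> /finite_seqP[s sI]; apply: infE.
  apply: (@finite_dim_of_supp _ _ _ H _ (undup s)); first exact: undup_uniq.
  by move=> x i _ _; have : [set: I] i by []; rewrite sI mem_undup.
(* The index set is countable and infinite, so the basis can be renumbered by the naturals. *)
have [h /= hb] : exists h : I -> nat, bijective h.
  have /card_set_bijP[h] : ([set: I] #= [set: nat])%card.
    by apply: Cantor_Bernstein => //; exact/infiniteP.
  by rewrite setTT_bijective; exists h.
have [h' hK h'K] := hb.
have [H'] := hamel_reindex (Bijective h'K hK) H.
by exists (vec H'); exact: seq_of_hamel.
Qed.

Theorem theorem3p7 (R : realType) (E : tvsType R) (hE : hausdorff_space E) :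
  (exists V : tvsType R, is_phi V /\ top_isomorphic E V) <->
  [/\ infinite_dimensional E, @kR_space R E &
      forall K : set E, compact K -> ~ infinite_dim_set K].
Proof.
split=> [[V [pV iV]]|[infE kR cK]].
  have [[b [ib sb]] fE] := is_phi_top_isomorphic pV iV.
  have [H] := hamel_of_seq ib sb.
  split; [exact: phi_infinite_dimensional H|exact: phi_kR H fE|].
  by move=> K /(phi_compact H fE) fK; apply.
exists E; split; first exact: is_phi_of_kR.
exists id; split => //; first by move=> x; exact: cvg_id.
by exists id => // x; exact: cvg_id.
Qed.
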